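(* Let $I=[p,q]\subset\mathbb{R}$ be an interval with $p<q$, and let $n,m,l\ge 1$ be integers. Let $\alpha_i,\lambda_i\ge 0$ ($1\le i\le n$), $\beta_j,\mu_j\ge 0$ ($1\le j\le m$) and $\gamma_k,\nu_k\ge 0$ ($1\le k\le l$) be real coefficients whose sums $\alpha=\sum_{i=1}^n\alpha_i$, $\beta=\sum_{j=1}^m\beta_j$, $\gamma=\sum_{k=1}^l\gamma_k$, $\lambda=\sum_{i=1}^n\lambda_i$, $\mu=\sum_{j=1}^m\mu_j$, $\nu=\sum_{k=1}^l\nu_k$ satisfy $\alpha+\beta-\gamma=1$ with $\alpha,\beta\in(0,1]$, and $\lambda+\mu-\nu=1$ with $\lambda,\mu\in(0,1]$. Let $c\in(p,q)$, let $a_i,b_j,c_k\in[p,c]$ and $r_i,s_j,t_k\in[c,q]$ (same index ranges), so that $$\max\{\max_i a_i,\max_j b_j,\max_k c_k\}\le c\le \min\{\min_i r_i,\min_j s_j,\min_k t_k\}.$$ Put $$a=\frac1\alpha\sum_{i=1}^n\alpha_i a_i,\quad b=\frac1\beta\sum_{j=1}^m\beta_j b_j,\quad r=\frac1\lambda\sum_{i=1}^n\lambda_i r_i,\quad s=\frac1\mu\sum_{j=1}^m\mu_j s_j,$$ and assume that $c_k\in\mathrm{conv}\{a,b\}$ and $t_k\in\mathrm{conv}\{r,s\}$ for every $k$. Suppose that $$\sum_{i=1}^n\alpha_i a_i^2+\sum_{j=1}^m\beta_j b_j^2-\sum_{k=1}^l\gamma_k c_k^2-\Big(\sum_{i=1}^n\alpha_i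 a_i+\sum_{j=1}^m\beta_j b_j-\sum_{k=1}^l\gamma_k c_k\Big)^2$$ $$=\sum_{i=1}^n\lambda_i r_i^2+\sum_{j=1}^m\mu_j s_j^2-\sum_{k=1}^l\nu_k t_k^2-\Big(\sum_{i=1}^n\lambda_i r_i+\sum_{j=1}^m\mu_j s_j-\sum_{k=1}^l\nu_k t_k\Big)^2.$$ Then for every $f\in K_1^c(I)$, $$\sum_{i=1}^n\alpha_i f(a_i)+\sum_{j=1}^m\beta_j f(b_j)-\sum_{k=1}^l\gamma_k f(c_k)-f\Big(\sum_{i=1}^n\alpha_i a_i+\sum_{j=1}^m\beta_j b_j-\sum_{k=1}^l\gamma_k c_k\Big)$$ $$\le\sum_{i=1}^n\lambda_i f(r_i)+\sum_{j=1}^m\mu_j f(s_j)-\sum_{k=1}^l\nu_k f(t_k)-f\Big(\sum_{i=1}^n\lambda_i r_i+\sum_{j=1}^m\mu_j s_j-\sum_{k=1}^l\nu_k t_k\Big).$$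
   Context: For an interval $I\subset\mathbb{R}$ and a point $c$ in the interior of $I$, a function $f:I\to\mathbb{R}$ is called 3-convex at the point $c$ if there exists a real constant $A$ such that the function $F(x)=f(x)-\frac A2x^2$ is concave on $I\cap(-\infty,c]$ and convex on $I\cap[c,\infty)$. $K_1^c(I)$ denotes the class of all functions $f:I\to\mathbb{R}$ that are 3-convex at the point $c$. For real numbers $x,y$, $\mathrm{conv}\{x,y\}$ is the closed interval with endpoints $x$ and $y$. *)

(* Defs.v *)
(* MathComp-Analysis, over an arbitrary R : realType. *)
From mathcomp Require Import all_boot all_order all_algebra.
From mathcomp Require Import all_classical all_reals all_analysis.

Set Implicit Arguments.
Unset Strict Implicit.
Unset Printing Implicit Defensive.

Import Order.TTheory GRing.Theory Num.Theory.
Local Open Scope classical_set_scope.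
Local Open Scope convex_scope.
Local Open Scope ring_scope.

(* Counterpart of the library's convex_function, with the reverse inequality. *)
Definition concave_function (R : numFieldType) (E : lmodType R)
    (E' := convex_lmodType E) (D : set E') (f : E' -> R^o) : Prop :=
  forall t : {i01 R},
    {in D &, forall x y : E', (f x <| t |> f y <= f (x <| t |> y))%R}.

(* K1 c I is the class of functions that are 3-convex at c. It is meant for an
   interval I and c in its interior. A function I -> R is represented by a
   total function R -> R, of which only the values on I matter. *)
Definition K1 (R : realType) (c : R) (I : set R) : set (R -> R) :=
  [set f | exists A : R,
     let F := fun x : R^o => f x - A / 2 * x ^+ 2 : R^o in
     concave_function (I `&` [set x | x <= c]) F /\
     convex_function (I `&` [set x | c <= x]) F].

Definition conv_pair (R : realType) (x y : R) : interval R :=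
  `[Num.min x y, Num.max x y].

(* Main.v *)
(* If G is convex on [u, v], L is the affine function agreeing with G at a and
   b, and the c_k lie between a and b, then so does
   x = alpha a + beta b - sum gamma_k c_k, because 1 - alpha, 1 - beta >= 0.
   Hence G x <= L x = alpha G(a) + beta G(b) - sum gamma_k L(c_k), and
   G <= L at the c_k together with Jensen's inequality for a and b gives
   G x <= sum alpha_i G(a_i) + sum beta_j G(b_j) - sum gamma_k G(c_k).
   Apply this to G = -F on [p, c] and to G = F on [c, q], where
   F z = f z - A/2 z^2: the two F-expressions are separated by 0, and their
   quadratic parts agree by hypothesis. *)
Require Import Defs.
From mathcomp Require Import all_boot all_order all_algebra.
From mathcomp Require Import all_classical all_reals all_analysis.
From mathcomp Require Import ring lra.

Set Implicit Arguments.
Unset Strict Implicit.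
Unset Printing Implicit Defensive.

Import Order.TTheory GRing.Theory Num.Theory.
Local Open Scope classical_set_scope.
Local Open Scope ring_scope.

(** Trades the bundled weight in [{i01 R}] for two real weights of sum 1, the form in which
    quotients can be supplied. *)
Lemma convex_functionD (R : realType) (D : set R) (G : R^o -> R^o)
    (w1 w2 x y : R) :
  convex_function D G -> D x -> D y -> 0 <= w1 -> 0 <= w2 -> w1 + w2 = 1 ->
  G (w1 * x + w2 * y) <= w1 * G x + w2 * G y.
Proof.
move=> cG Dx Dy w1_ge0 w2_ge0 w12.
have w1_le1 : w1 <= 1 by lra.
have -> : w2 = 1 - w1 by lra.
have := cG (Itv01 w1_ge0 w1_le1) x y (mem_set Dx) (mem_set Dy).
by rewrite !convRE.
Qed.

Lemma concave_convexN (R : realType) (D : set R) (G : R^o -> R^o) :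
  concave_function D G -> convex_function D (fun z => - G z : R^o).
Proof.
by move=> cG t x y Dx Dy /=; have := cG t x y Dx Dy; rewrite -convN lerN2.
Qed.

(* Produces the barycenter z existentially, so that a family of total weight 0
   needs no special treatment. *)
Lemma convex_barycenter (R : realType) (u v : R) (G : R^o -> R^o)
    (I : Type) (e : seq I) (w x : I -> R) :
  u <= v -> convex_function [set` `[u, v]] G ->
  (forall i, 0 <= w i) -> (forall i, x i \in `[u, v]) ->
  exists z, [/\ z \in `[u, v],
    \sum_(i <- e) w i * x i = (\sum_(i <- e) w i) * z &
    (\sum_(i <- e) w i) * G z <= \sum_(i <- e) w i * G (x i)].
Proof.
move=> uv cG w_ge0 xuv; elim: e => [|i e [z [zuv zE Gz]]].
  by exists u; rewrite !big_nil !mul0r; split => //; rewrite in_itv /= lexx.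
rewrite !big_cons; set W := \sum_(j <- e) w j in zE Gz *.
have W_ge0 : 0 <= W by apply: sumr_ge0.
have wi_ge0 := w_ge0 i.
(* If the total weight vanishes, so do both nonnegative parts, and the old [z] still serves.
   Otherwise the new barycenter is the average of [x i] and [z] with weights proportional to [w i]
   and [W]. *)
have [wW0|wW_gt0] : w i + W = 0 \/ 0 < w i + W by lra.
  have wi0 : w i = 0 by lra.
  have W0 : W = 0 by lra.
  by exists z; move: zE Gz; rewrite wi0 W0 !(mul0r, add0r).
pose t := w i / (w i + W); pose t' := W / (w i + W).
have t_ge0 : 0 <= t by rewrite divr_ge0 // ltW.
have t'_ge0 : 0 <= t' by rewrite divr_ge0 // ltW.
have wWN0 : w i + W != 0 by rewrite gt_eqF.
have tE : (w i + W) * t = w i by rewrite /t mulrC divfK.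
have t'E : (w i + W) * t' = W by rewrite /t' mulrC divfK.
have tt' : t + t' = 1 by rewrite -mulrDl divff.
clearbody t t'; exists (t * x i + t' * z); split.
- move: (xuv i) zuv; rewrite !in_itv /= => /andP[? ?] /andP[? ?].
  by apply/andP; split; nra.
- by rewrite zE mulrDr !mulrA tE t'E.
- have Gt := convex_functionD cG (xuv i) zuv t_ge0 t'_ge0 tt'.
  apply: (@le_trans _ _ ((w i + W) * (t * G (x i) + t' * G z))).
    by rewrite ler_wpM2l // ltW.
  by rewrite mulrDr !mulrA tE t'E lerD2l.
Qed.

(** A positive total weight can be divided out, so the barycenter of [convex_barycenter] can only be
    [z]. *)
Lemma convex_jensen (R : realType) (u v : R) (G : R^o -> R^o)
    (I : finType) (w x : I -> R) (W := \sum_i w i)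
    (z := W^-1 * \sum_i w i * x i) :
  u <= v -> convex_function [set` `[u, v]] G ->
  (forall i, 0 <= w i) -> 0 < W -> (forall i, x i \in `[u, v]) ->
  z \in `[u, v] /\ W * G z <= \sum_i w i * G (x i).
Proof.
move=> uv cG w_ge0 W_gt0 xuv.
have [z' [z'uv z'E Gz']] := convex_barycenter (index_enum I) uv cG w_ge0 xuv.
suff -> : z = z' by [].
by rewrite /z z'E mulKf // gt_eqF.
Qed.

(** Supplies the affine function L as [k * z + d]. Since [conv_pair] is symmetric, [a <= b] may be
    assumed. *)
Lemma convex_chord (R : realType) (D : set R) (G : R^o -> R^o) (a b : R) :
  convex_function D G -> D a -> D b ->
  exists k d : R, [/\ G a = k * a + d, G b = k * b + d &
    forall z, z \in conv_pair a b -> G z <= k * z + d].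
Proof.
move=> cG; wlog ab : a b / a <= b.
  move=> W Da Db; have [ab|/ltW ba] := leP a b; first exact: W.
  have [k [d [Gb Ga Gz]]] := W b a ba Db Da.
  by exists k, d; split=> // z; rewrite /conv_pair minC maxC; exact: Gz.
move=> Da Db; rewrite /conv_pair (min_idPl ab) (max_idPr ab).
have [<-|aNb] := eqVneq a b.
  (* When [a = b] the slope quotient is meaningless, but the pair spans a single point and a
     constant suffices. *)
  exists 0, (G a); rewrite mul0r add0r; split=> // z; rewrite in_itv /= => az.
  by rewrite mul0r add0r (_ : z = a) //; lra.
have ba_gt0 : 0 < b - a by rewrite subr_gt0 lt_neqAle aNb.
have baN0 : b - a != 0 by rewrite gt_eqF.
pose k := (G b - G a) / (b - a).
exists k, (G a - k * a); split; [by ring| |].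
  by rewrite /k; field.
move=> z; rewrite in_itv /= => /andP[az zb].
have t_ge0 : 0 <= (b - z) / (b - a) by rewrite divr_ge0 ?subr_ge0// ltW.
have t'_ge0 : 0 <= (z - a) / (b - a) by rewrite divr_ge0 ?subr_ge0// ltW.
have tt' : (b - z) / (b - a) + (z - a) / (b - a) = 1 by field.
have := convex_functionD cG Da Db t_ge0 t'_ge0 tt'.
have -> : (b - z) / (b - a) * a + (z - a) / (b - a) * b = z by field.
by move/le_trans; apply; rewrite le_eqVlt (_ : _ == _) //; apply/eqP;
   rewrite /k; field.
Qed.

(** Take [a <= b]. As the [g k] sum to [alpha + beta - 1], replacing every [c_ k] by [b] bounds the
    point below by [alpha * a + (1 - alpha) * b >= a], and replacing it by [a] bounds the point
    above by [(1 - beta) * a + beta * b <= b]. The case [b < a] is symmetric. *)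
Lemma conv_pair_extrapolation (R : realType) (K : finType) (g c_ : K -> R)
    (alpha beta a b : R) :
  alpha <= 1 -> beta <= 1 -> alpha + beta - \sum_k g k = 1 ->
  (forall k, 0 <= g k) -> (forall k, c_ k \in conv_pair a b) ->
  alpha * a + beta * b - \sum_k g k * c_ k \in conv_pair a b.
Proof.
move=> a1 b1 abg g_ge0; rewrite /conv_pair => cab.
have lo : (\sum_k g k) * Num.min a b <= \sum_k g k * c_ k.
  rewrite mulr_suml ler_sum // => k _; apply: ler_wpM2l => //.
  by have := cab k; rewrite in_itv /= => /andP[].
have hi : \sum_k g k * c_ k <= (\sum_k g k) * Num.max a b.
  rewrite mulr_suml ler_sum // => k _; apply: ler_wpM2l => //.
  by have := cab k; rewrite in_itv /= => /andP[].
have gE : \sum_k g k = alpha + beta - 1 by lra.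
move: lo hi; rewrite gE in_itv /=.
by case: (leP a b) => ab lo hi; apply/andP; split; nra.
Qed.

(** A Jensen-Mercer inequality: the weights sum to 1 but those of the [c_ k] enter negatively, so
    Jensen's inequality alone does not apply. *)
Lemma convex_jensen_mercer (R : realType) (u v : R) (G : R^o -> R^o)
    (I J K : finType) (al a_ : I -> R) (be b_ : J -> R) (g c_ : K -> R)
    (alpha := \sum_i al i) (beta := \sum_j be j)
    (a := alpha^-1 * \sum_i al i * a_ i) (b := beta^-1 * \sum_j be j * b_ j) :
  u <= v -> convex_function [set` `[u, v]] G ->
  (forall i, 0 <= al i) -> (forall j, 0 <= be j) -> (forall k, 0 <= g k) ->
  alpha \in `]0, 1] -> beta \in `]0, 1] -> alpha + beta - \sum_k g k = 1 ->
  (forall i, a_ i \in `[u, v]) -> (forall j, b_ j \in `[u, v]) ->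
  (forall k, c_ k \in conv_pair a b) ->
  G (\sum_i al i * a_ i + \sum_j be j * b_ j - \sum_k g k * c_ k) <=
  \sum_i al i * G (a_ i) + \sum_j be j * G (b_ j) - \sum_k g k * G (c_ k).
Proof.
move=> uv cG al_ge0 be_ge0 g_ge0.
rewrite !in_itv /= => /andP[alpha_gt0 alpha1] /andP[beta_gt0 beta1] abg.
move=> auv buv cab.
have [Da Ga] := convex_jensen uv cG al_ge0 alpha_gt0 auv.
have [Db Gb] := convex_jensen uv cG be_ge0 beta_gt0 buv.
rewrite -/alpha -/beta -/a -/b in Da Ga Db Gb.
have aE : \sum_i al i * a_ i = alpha * a by rewrite mulVKf // gt_eqF.
have bE : \sum_j be j * b_ j = beta * b by rewrite mulVKf // gt_eqF.
rewrite aE bE.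
have xab := conv_pair_extrapolation alpha1 beta1 abg g_ge0 cab.
have [k [d [aL bL zL]]] := convex_chord cG Da Db.
have Gc : \sum_i g i * G (c_ i) <= k * \sum_i g i * c_ i + d * \sum_i g i.
  rewrite !mulr_sumr -big_split /= ler_sum // => i _.
  rewrite (_ : _ + _ = g i * (k * c_ i + d)); last by ring.
  by rewrite ler_wpM2l // zL.
(* The constants [d] balance because [alpha + beta] minus the sum of the [g i] is 1; the rest is
   linear in [k * a], [k * b] and the sums. *)
have := zL _ xab; rewrite aL in Ga; rewrite bL in Gb.
have gE : \sum_i g i = alpha + beta - 1 by lra.
rewrite gE in Gc; move: Ga Gb Gc; lra.
Qed.

Theorem theorem4 (R : realType) (p q : R) (n m l : nat)
    (alpha_ lambda_ a_ r_ : 'I_n -> R)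
    (beta_ mu_ b_ s_ : 'I_m -> R)
    (gamma_ nu_ c_ t_ : 'I_l -> R) (c : R)
    (alpha := \sum_(i < n) alpha_ i) (beta := \sum_(j < m) beta_ j)
    (gamma := \sum_(k < l) gamma_ k)
    (lambda := \sum_(i < n) lambda_ i) (mu := \sum_(j < m) mu_ j)
    (nu := \sum_(k < l) nu_ k)
    (a := alpha^-1 * \sum_(i < n) alpha_ i * a_ i)
    (b := beta^-1 * \sum_(j < m) beta_ j * b_ j)
    (r := lambda^-1 * \sum_(i < n) lambda_ i * r_ i)
    (s := mu^-1 * \sum_(j < m) mu_ j * s_ j)
    (x := \sum_(i < n) alpha_ i * a_ i + \sum_(j < m) beta_ j * b_ j
          - \sum_(k < l) gamma_ k * c_ k)
    (y := \sum_(i < n) lambda_ i * r_ i + \sum_(j < m) mu_ j * s_ j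
          - \sum_(k < l) nu_ k * t_ k) :
  p < q ->
  (1 <= n)%N -> (1 <= m)%N -> (1 <= l)%N ->
  (forall i, 0 <= alpha_ i) -> (forall i, 0 <= lambda_ i) ->
  (forall j, 0 <= beta_ j) -> (forall j, 0 <= mu_ j) ->
  (forall k, 0 <= gamma_ k) -> (forall k, 0 <= nu_ k) ->
  alpha + beta - gamma = 1 -> alpha \in `]0, 1] -> beta \in `]0, 1] ->
  lambda + mu - nu = 1 -> lambda \in `]0, 1] -> mu \in `]0, 1] ->
  c \in `]p, q[ ->
  (forall i, a_ i \in `[p, c]) -> (forall j, b_ j \in `[p, c]) ->
  (forall k, c_ k \in `[p, c]) ->
  (forall i, r_ i \in `[c, q]) -> (forall j, s_ j \in `[c, q]) ->
  (forall k, t_ k \in `[c, q]) ->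
  (forall k, c_ k \in conv_pair a b) ->
  (forall k, t_ k \in conv_pair r s) ->
  \sum_(i < n) alpha_ i * a_ i ^+ 2 + \sum_(j < m) beta_ j * b_ j ^+ 2
    - \sum_(k < l) gamma_ k * c_ k ^+ 2 - x ^+ 2
  = \sum_(i < n) lambda_ i * r_ i ^+ 2 + \sum_(j < m) mu_ j * s_ j ^+ 2
    - \sum_(k < l) nu_ k * t_ k ^+ 2 - y ^+ 2 ->
  forall f : R -> R, K1 c [set` `[p, q]] f ->
  \sum_(i < n) alpha_ i * f (a_ i) + \sum_(j < m) beta_ j * f (b_ j)
    - \sum_(k < l) gamma_ k * f (c_ k) - f x
  <= \sum_(i < n) lambda_ i * f (r_ i) + \sum_(j < m) mu_ j * f (s_ j)
    - \sum_(k < l) nu_ k * f (t_ k) - f y.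

Proof.
move=> _ _ _ _ al_ge0 la_ge0 be_ge0 mu_ge0 ga_ge0 nu_ge0 abg al01 be01 lmn
  la01 mu01.
rewrite in_itv /= => /andP[/ltW pc /ltW cq] ap bp _ rq sq _ cab trs.
move=> sqE f [A [ccv cvx]].
pose F z := f z - A / 2 * z ^+ 2.
(* Since [c <= q], the part of [[p, q]] to the left of [c] is exactly [[p, c]]; the right part is
   treated likewise. *)
have cvxN : convex_function [set` `[p, c]] (fun z : R^o => - F z : R^o).
  rewrite (_ : [set` _] = [set` `[p, q]] `&` [set x | x <= c]).
    exact: concave_convexN.
  apply/seteqP; split => z /=; rewrite !in_itv /= => H; last by lra.
  by split; lra.
have cvxF : convex_function [set` `[c, q]] (F : R^o -> R^o).
  rewrite (_ : [set` _] = [set` `[p, q]] `&` [set x | c <= x]) //.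
  apply/seteqP; split => z /=; rewrite !in_itv /= => H; last by lra.
  by split; lra.
have left := convex_jensen_mercer pc cvxN al_ge0 be_ge0 ga_ge0 al01 be01 abg
  ap bp cab.
have right := convex_jensen_mercer cq cvxF la_ge0 mu_ge0 nu_ge0 la01 mu01 lmn
  rq sq trs.
have sumF (I : finType) (w z : I -> R) : \sum_i w i * F (z i) =
    \sum_i w i * f (z i) - A / 2 * \sum_i w i * z i ^+ 2.
  by rewrite mulr_sumr -sumrB; apply: eq_bigr => i _; rewrite /F; ring.
have sumNF (I : finType) (w z : I -> R) : \sum_i w i * - F (z i) =
    - \sum_i w i * F (z i).
  by rewrite -sumrN; apply: eq_bigr => i _; rewrite mulrN.
move: left right; rewrite -/x -/y !sumNF !sumF /F => left right.
(* The sign of [A] is unknown, but the quadratic hypothesis is an equality and may be scaled by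
   [A / 2] all the same. *)
have := congr1 ( *%R (A / 2)) sqE; move: left right; lra.
Qed.
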